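(* Let $M$ be a smooth odd-dimensional manifold and let $\mathcal J=(F,\eta,\pi,\theta,\varphi)$ represent a generalized contact structure on $M$ (that is, a generalized almost contact structure such that $\Gamma(L)$ is closed under the Courant bracket). Then the Nijenhuis operator $\mathrm{Nij}$ restricted to $L^*=L_\eta\oplus E^{(0,1)}$ is $$\mathrm{Nij}=-\frac12\,F\wedge(\rho^*d\eta)^{(2,0)},$$ where $(\rho^*d\eta)^{(2,0)}$ is the $\wedge^2E^{(1,0)}$-component of the pull-back of $d\eta$ via the anchor map $\rho$ on $L^*$.
   Context: Setting: on sections of $TM\oplus T^*M$ put $\langle X+\alpha,Y+\beta\rangle=\frac12(\iota_X\beta+\iota_Y\alpha)$ and the Courant bracket $[\![X+\alpha,Y+\beta]\!]=[X,Y]+\mathcal L_X\beta-\mathcal L_Y\alpha-\frac12 d(\iota_X\beta-\iota_Y\alpha)$. Both are extended complex-linearly to $(TM\oplus T^*M)_{\mathbb C}$, and $\rho$ denotes the projection (anchor) onto $TM_{\mathbb C}$. For a 2-form $\theta$, $\theta^\flat X=\theta(X,\cdot)$; for a bivector field $\pi$, $(\pi^\sharp\alpha)(\beta)=\pi(\alpha,\beta)$; for a $(1,1)$-tensor $\varphi$, $\varphi^*\alpha=\alpha\circ\varphi$. Convention: $d\eta(X,Y)=X\eta(Y)-Y\eta(X)-\eta([X,Y])$. A generalized almost contact pair on $M$ is a bundle endomorphism $\Phi$ of $TM\oplus T^*M$ together with a section $F+\eta$ ($F$ a vector field, $\eta$ a 1-form) such that $\Phi+\Phi^*=0$ (adjoint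 with respect to $\langle\cdot,\cdot\rangle$), $\eta(F)=1$, $\Phi(F)=0$, $\Phi(\eta)=0$ and $\Phi\circ\Phi=-\mathbb I+F\odot\eta$, where $(F\odot\eta)(X+\alpha)=\eta(X)F+\alpha(F)\eta$. Two pairs are equivalent if they have the same $\Phi$ and $\eta'=f\eta$, $F'=\frac1fF$ for a nowhere-zero function $f$; a generalized almost contact structure is an equivalence class. In components $\Phi=\begin{pmatrix}\varphi&\pi^\sharp\\ \theta^\flat&-\varphi^*\end{pmatrix}$ with $\varphi$ a $(1,1)$-tensor, $\pi$ a bivector field, $\theta$ a 2-form, and the structure is denoted $\mathcal J=(F,\eta,\pi,\theta,\varphi)$. Bundles: $\ker\eta\subset TM$ and $\ker F=\{\alpha\in T^*M:\alpha(F)=0\}$; $L_F$ and $L_\eta$ are the complex line bundles spanned by $F$ and $\eta$; $E^{(1,0)}=\{e-i\Phi(e): e\in\ker\eta\oplus\ker F\}$, $E^{(0,1)}=\{e+i\Phi(e): e\in\ker\eta\oplus\ker F\}$; $L=L_F\oplus E^{(1,0)}$, $L^*=L_\eta\oplus E^{(0,1)}$. Nijenhuis operator: for sections $v_0,v_1,v_2$ of $L^*$, $$\mathrm{Nij}(v_0,v_1,v_2)=\tfrac13\big(\langle[\![v_0,v_1]\!],v_2\rangle+\langle[\![v_1,v_2]\!],v_0\rangle+\langle[\![v_2,v_0]\!],v_1\rangle\big),$$ an alternating 3-form on $L^*$, i.e. a section of $\wedge^3(L^* )^*\cong\wedge^3L$. Conventions for the right-hand side: $F$ is viewed as the linear functional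 on $L^*$ with $F(\eta)=1$ and $F|_{E^{(0,1)}}=0$ (evaluation of 1-forms on $F$; so $L\cong(L^* )^*$ via $2\langle\cdot,\cdot\rangle$). Under this duality $E^{(1,0)}$ is the dual of $E^{(0,1)}$, and $(\rho^*d\eta)^{(2,0)}$ is the alternating 2-form on $L^*$ that is annihilated by contraction with $\eta$ and satisfies $(\rho^*d\eta)^{(2,0)}(v_0,v_1)=d\eta(\rho(v_0),\rho(v_1))$ for $v_0,v_1\in E^{(0,1)}$. The wedge product is $(F\wedge\omega)(v_0,v_1,v_2)=F(v_0)\omega(v_1,v_2)+F(v_1)\omega(v_2,v_0)+F(v_2)\omega(v_0,v_1)$. *)

(* Defs.v *)
From HB Require Import structures.
From mathcomp Require Import all_boot all_order all_algebra.
From mathcomp Require Import all_classical all_reals.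
From mathcomp Require Import interval_inference topology normedtype derive.
From mathcomp Require Import ring.
Set Implicit Arguments.
Unset Strict Implicit.
Unset Printing Implicit Defensive.
Import Order.TTheory GRing.Theory Num.Theory.
Import numFieldNormedType.Exports.
Local Open Scope classical_set_scope.
Local Open Scope ring_scope.

Section smooth_on_open.
Context {R : realType} {n : nat}.
Implicit Types (U : set 'rV[R]_n) (f g : 'rV[R]_n -> R).

Definition pderiv (i : 'I_n) f : 'rV[R]_n -> R :=
  fun x => 'D_(delta_mx 0 i : 'rV[R]_n) f x.

(* The partial derivatives of order at most k exist and are continuous on U. *)
Fixpoint Ck k U f : Prop :=
  (forall x, U x -> {for x, continuous f}) /\
  if k is k'.+1 then
    forall i : 'I_n,
      (forall x, U x -> derivable f x (delta_mx 0 i : 'rV[R]_n)) /\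
      Ck k' U (pderiv i f)
  else True.

Definition Cinf U f : Prop := forall k, Ck k U f.

Lemma Ck_cont k U f : Ck k U f -> forall x, U x -> {for x, continuous f}.
Proof. by case: k => [|k] []. Qed.

Lemma CkW k U f : Ck k.+1 U f -> Ck k U f.
Proof.
elim: k f => [|k IH] f [cf df]; first by split.
by split=> // i; have [di Di] := df i; split => //; exact: IH.
Qed.

Lemma Ck_eq k U f g : open U -> (forall x, U x -> f x = g x) ->
  Ck k U f -> Ck k U g.
Proof.
move=> oU; have nfg (f' g' : 'rV[R]_n -> R) x :
    (forall y, U y -> f' y = g' y) -> U x -> {near x, f' =1 g'}.
  by move=> fg Ux; apply: filterS (open_nbhs_nbhs (conj oU Ux)) => y; exact: fg.
have cfg (f' g' : 'rV[R]_n -> R) : (forall y, U y -> f' y = g' y) ->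
    (forall x, U x -> {for x, continuous f'}) ->
    forall x, U x -> {for x, continuous g'}.
  move=> fg cf x Ux; rewrite /prop_for /continuous_at -fg //.
  exact: cvg_trans (near_eq_cvg (nfg _ _ x fg Ux)) (cf x Ux).
elim: k f g => [|k IH] f g fg [cf df]; split; [exact: cfg cf|by []|exact: cfg cf|].
move=> i; have [di Di] := df i; split.
  by move=> x Ux; exact: near_eq_derivable (nfg _ _ x fg Ux) (di x Ux).
apply: IH Di => x Ux; rewrite /pderiv.
exact: near_eq_derive (nfg _ _ x fg Ux).
Qed.

Lemma Ck_cst k U (a : R) : Ck k U (fun=> a).
Proof.
elim: k a => [|k IH] a; (split; first by move=> x _; exact: cst_continuous).
  by [].
move=> i; split=> [x _|]; first exact: derivable_cst.
rewrite (_ : pderiv _ _ = fun=> 0); first exact: IH.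
by apply/funext => x; rewrite /pderiv derive_cst.
Qed.

Lemma CkD k U f g : open U ->
  Ck k U f -> Ck k U g -> Ck k U (fun x => f x + g x).
Proof.
move=> oU; elim: k f g => [|k IH] f g Cf Cg.
all: split;
  first by move=> x Ux; exact: cvgD (Ck_cont Cf Ux) (Ck_cont Cg Ux).
  by [].
move=> i; case: Cf Cg => _ /(_ i)[df Df] [_ /(_ i)[dg Dg]]; split.
  by move=> x Ux; exact: derivableD (df x Ux) (dg x Ux).
apply: Ck_eq (IH _ _ Df Dg) => // x Ux.
by rewrite /pderiv; apply/esym; exact: deriveD (df x Ux) (dg x Ux).
Qed.

Lemma CkM k U f g : open U ->
  Ck k U f -> Ck k U g -> Ck k U (fun x => f x * g x).
Proof.
move=> oU; elim: k f g => [|k IH] f g Cf Cg.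
all: split;
  first by move=> x Ux; exact: cvgM (Ck_cont Cf Ux) (Ck_cont Cg Ux).
  by [].
move=> i; have Cf' := CkW Cf; have Cg' := CkW Cg.
case: Cf Cg => _ /(_ i)[df Df] [_ /(_ i)[dg Dg]]; split.
  by move=> x Ux; exact: derivableM (df x Ux) (dg x Ux).
apply: Ck_eq (CkD oU (IH _ _ Cf' Dg) (IH _ _ Cg' Df)) => // x Ux.
by rewrite /pderiv; apply/esym; exact: deriveM (df x Ux) (dg x Ux).
Qed.

End smooth_on_open.

(* cmap is only meaningful on cdom, and cinv on the image of cdom. *)
Record chart (R : realType) (n : nat) (T : topologicalType) := Chart {
  cdom : set T;
  cmap : T -> 'rV[R]_n;
  cinv : 'rV[R]_n -> T;
  cdom_open : open cdom;
  cimg_open : open (cmap @` cdom);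
  cmapK : forall x, cdom x -> cinv (cmap x) = x;
  cmap_cont : {within cdom, continuous cmap};
  cinv_cont : {within cmap @` cdom, continuous cinv} }.

Definition transition_smooth (R : realType) n (T : topologicalType)
    (c c' : chart R n T) : Prop :=
  forall i : 'I_n, Cinf (cmap c @` (cdom c `&` cdom c'))
                        (fun u => cmap c' (cinv c u) 0 i).

Record manifold (R : realType) (n : nat) := Manifold {
  msort :> topologicalType;
  m_hausdorff : hausdorff_space msort;
  m_second_countable : @second_countable msort;
  atlas : set (chart R n msort);
  atlas_cover : forall x : msort, exists2 c, atlas c & cdom c x;
  atlas_smooth : forall c c', atlas c -> atlas c' -> transition_smooth c c' }.

Section smooth_functions.
Context {R : realType} {n : nat} (M : manifold R n).

Definition smooth (f : M -> R) : Prop :=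
  forall c, atlas c -> Cinf (cmap c @` cdom c) (f \o cinv c).

Definition smooth_pred : {pred M -> R^o} := fun f => `[< smooth f >].

Lemma smooth_cst (a : R) : smooth (fun=> a).
Proof. by move=> c _ k; exact: Ck_cst. Qed.

Lemma smoothD f g : smooth f -> smooth g -> smooth (fun x => f x + g x).
Proof.
by move=> sf sg c cM k; apply: CkD (sf c cM k) (sg c cM k); exact: cimg_open.
Qed.

Lemma smoothM f g : smooth f -> smooth g -> smooth (fun x => f x * g x).
Proof.
by move=> sf sg c cM k; apply: CkM (sf c cM k) (sg c cM k); exact: cimg_open.
Qed.

Lemma smooth_subring_closed : subring_closed smooth_pred.
Proof.
split; first exact/asboolP/smooth_cst.
- move=> f g /asboolP sf /asboolP sg; apply/asboolP.
  have := smoothD sf (smoothM (smooth_cst (- 1)) sg).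
  by congr smooth; apply/funext => x; rewrite mulN1r.
- by move=> f g /asboolP sf /asboolP sg; exact/asboolP/smoothM.
Qed.

HB.instance Definition _ :=
  GRing.isSubringClosed.Build _ smooth_pred smooth_subring_closed.

Lemma smooth_submod_closed : submod_closed smooth_pred.
Proof.
split; first exact/asboolP/smooth_cst.
move=> a f g /asboolP sf /asboolP sg; apply/asboolP.
exact: smoothD (smoothM (smooth_cst a) sf) sg.
Qed.

HB.instance Definition _ :=
  GRing.isSubmodClosed.Build _ _ smooth_pred smooth_submod_closed.

Record Cinfty := MkCinfty { cfun :> M -> R^o; _ : cfun \in smooth_pred }.

HB.instance Definition _ := [isSub for cfun].
HB.instance Definition _ := [Choice of Cinfty by <:].
HB.instance Definition _ :=
  GRing.SubChoice_isSubComPzRing.Build _ _ Cinfty smooth_subring_closed.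
HB.instance Definition _ := [SubZmodule_isSubLmodule of Cinfty by <:].

Lemma Cinfty_scaleAl (a : R) (f g : Cinfty) : a *: (f * g) = (a *: f) * g.
Proof. by apply: val_inj; apply/funext => x; exact: mulrA. Qed.

Lemma Cinfty_scaleAr (a : R) (f g : Cinfty) : a *: (f * g) = f * (a *: g).
Proof. by rewrite mulrC Cinfty_scaleAl mulrC. Qed.

(* Smooth vector fields on M are taken to be the R-linear derivations of
   C^oo(M); [vfield] is a module over [Cinfty]. *)

Definition derivation (X : Cinfty -> Cinfty) : Prop :=
  (forall (a : R) f g, X (a *: f + g) = a *: X f + X g) /\
  (forall f g, X (f * g) = X f * g + f * X g).

Definition derivation_pred : {pred Cinfty -> Cinfty^o} :=
  fun X => `[< derivation X >].

Lemma derivation_submod_closed : submod_closed derivation_pred.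
Proof.
split; first apply/asboolP; first split=> [a f g|f g].
- by rewrite scaler0 addr0.
- by rewrite mul0r mulr0 addr0.
move=> h X Y /asboolP[XL XM] /asboolP[YL YM]; apply/asboolP; split=> [a f g|f g].
  change (h * X (a *: f + g) + Y (a *: f + g) =
          a *: (h * X f + Y f) + (h * X g + Y g)).
  by rewrite XL YL mulrDr -Cinfty_scaleAr scalerDr addrACA.
change (h * X (f * g) + Y (f * g) = (h * X f + Y f) * g + f * (h * X g + Y g)).
by rewrite XM YM !mulrDr mulrDl !mulrA (mulrC h f) addrACA.
Qed.

HB.instance Definition _ :=
  GRing.isSubmodClosed.Build _ _ derivation_pred derivation_submod_closed.

Record vfield := MkVfield {
  vfun :> Cinfty -> Cinfty^o; _ : vfun \in derivation_pred }.

HB.instance Definition _ := [isSub for vfun].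
HB.instance Definition _ := [Choice of vfield by <:].
HB.instance Definition _ := [SubChoice_isSubLmodule of vfield by <:].

Lemma vfieldL (X : vfield) (a : R) f g : X (a *: f + g) = a *: X f + X g.
Proof. by have /asboolP[] := valP X. Qed.

Lemma vfieldM (X : vfield) f g : X (f * g) = X f * g + f * X g.
Proof. by have /asboolP[] := valP X. Qed.

Lemma vfieldD (X : vfield) f g : X (f + g) = X f + X g.
Proof. by have := vfieldL X 1 f g; rewrite !scale1r. Qed.

Lemma vfieldZ (X : vfield) (a : R) f : X (a *: f) = a *: X f.
Proof.
have X0 : X 0 = 0.
  by apply: (addrI (X 0)); rewrite -vfieldD !addr0.
by have := vfieldL X a f 0; rewrite X0 !addr0.
Qed.

Lemma vfieldB (X : vfield) f g : X (f - g) = X f - X g.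
Proof. by rewrite vfieldD -scaleN1r vfieldZ scaleN1r. Qed.

Lemma vfDE (X Y : vfield) f : (X + Y) f = X f + Y f. Proof. by []. Qed.
Lemma vfZE (h : Cinfty) (X : vfield) f : (h *: X) f = h * X f.
Proof. by []. Qed.

(* Tensor fields are taken to be C^oo(M)-multilinear maps on sections: a 1-form
   is a C^oo(M)-linear functional on vector fields. *)

Definition oform_pred : {pred vfield -> Cinfty^o} :=
  fun alpha => `[< linear alpha >].

Lemma oform_submod_closed : submod_closed oform_pred.
Proof.
split; first by apply/asboolP => f X Y; rewrite scaler0 addr0.
move=> h alpha beta /asboolP aL /asboolP bL; apply/asboolP => f X Y.
change (h * alpha (f *: X + Y) + beta (f *: X + Y) =
        f * (h * alpha X + beta X) + (h * alpha Y + beta Y)).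
rewrite aL bL; change (h * (f * alpha X + alpha Y) + (f * beta X + beta Y) =
        f * (h * alpha X + beta X) + (h * alpha Y + beta Y)).
by rewrite !mulrDr !mulrA (mulrC h f) addrACA.
Qed.

HB.instance Definition _ :=
  GRing.isSubmodClosed.Build _ _ oform_pred oform_submod_closed.

Record oform := MkOform {
  ofun :> vfield -> Cinfty^o; _ : ofun \in oform_pred }.

HB.instance Definition _ := [isSub for ofun].
HB.instance Definition _ := [Choice of oform by <:].
HB.instance Definition _ := [SubChoice_isSubLmodule of oform by <:].

Lemma oformL (alpha : oform) (f : Cinfty) X Y :
  alpha (f *: X + Y) = f * alpha X + alpha Y.
Proof. by have /asboolP/(_ f X Y) := valP alpha. Qed.

Definition lie_bracket_fun (X Y : vfield) : Cinfty -> Cinfty^o :=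
  fun f => X (Y f) - Y (X f).

Fact lie_bracket_subproof X Y : lie_bracket_fun X Y \in derivation_pred.
Proof.
apply/asboolP; split=> [a f g|f g]; rewrite /lie_bracket_fun.
  by rewrite !vfieldL scalerBr opprD addrACA.
rewrite !vfieldM !vfieldD !vfieldM.
move: (X (Y f)) (X (Y g)) (Y (X f)) (Y (X g)) (X f) (X g) (Y f) (Y g).
by rewrite /GRing.regular; move: f g => f g *; ring.
Qed.

Definition lie_bracket X Y : vfield := MkVfield (lie_bracket_subproof X Y).

Fact ext_d0_subproof (f : Cinfty) : (fun X : vfield => X f) \in oform_pred.
Proof. by apply/asboolP. Qed.

Definition ext_d0 (f : Cinfty) : oform := MkOform (ext_d0_subproof f).

Definition ext_d1 (eta : oform) (X Y : vfield) : Cinfty :=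
  X (eta Y) - Y (eta X) - eta (lie_bracket X Y).

Definition lie_form_fun (X : vfield) (beta : oform) : vfield -> Cinfty^o :=
  fun Y => X (beta Y) - beta (lie_bracket X Y).

Lemma lie_bracketDr X (f : Cinfty) Y Z :
  lie_bracket X (f *: Y + Z) =
  f *: lie_bracket X Y + (X f *: Y + lie_bracket X Z).
Proof.
apply: val_inj; apply/funext => g.
change (X (f * Y g + Z g) - (f * Y (X g) + Z (X g)) =
        f * (X (Y g) - Y (X g)) + (X f * Y g + (X (Z g) - Z (X g)))).
rewrite vfieldD vfieldM.
move: (X f) (X (Y g)) (Y (X g)) (Y g) (X (Z g)) (Z (X g)).
by rewrite /GRing.regular => *; ring.
Qed.

Fact lie_form_subproof X beta : lie_form_fun X beta \in oform_pred.
Proof.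
apply/asboolP => f Y Z; rewrite /lie_form_fun.
rewrite lie_bracketDr !oformL vfieldD vfieldM.
move: (X f) (beta Y) (X (beta Y)) (X (beta Z)) (beta (lie_bracket X Y)).
by move: (beta (lie_bracket X Z)); rewrite /GRing.regular /GRing.scale /= => *; ring.
Qed.

Definition lie_form X beta : oform := MkOform (lie_form_subproof X beta).

(* The pair (X, alpha) is the section X + alpha of TM (+) T^*M. *)
Definition sec : Type := (vfield * oform)%type.
HB.instance Definition _ := GRing.Lmodule.on sec.

Definition pairing (s t : sec) : Cinfty :=
  (2^-1 : R) *: (t.2 s.1 + s.2 t.1 : Cinfty).

Definition courant (s t : sec) : sec :=
  (lie_bracket s.1 t.1,
   lie_form s.1 t.2 - lie_form t.1 s.2
   - ext_d0 ((2^-1 : R) *: (t.2 s.1 - s.2 t.1 : Cinfty))).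

(* The pair (u, v) stands for u + i v; sections of a complexified bundle and
   complex-valued smooth functions are represented in this way. *)
Definition cplx (V : Type) : Type := (V * V)%type.
HB.instance Definition _ (V : zmodType) := GRing.Zmodule.on (cplx V).
HB.instance Definition _ (S : pzRingType) (V : lmodType S) :=
  GRing.Lmodule.on (cplx V).

Definition ofreal (V : zmodType) (v : V) : cplx V := (v, 0).

(* complex-linear extension of a real-linear map *)
Definition clin (U V : Type) (h : U -> V) (u : cplx U) : cplx V :=
  (h u.1, h u.2).

(* complex-bilinear extension of a real-bilinear map *)
Definition cbilin (U V : Type) (W : zmodType) (op : U -> V -> W)
    (u : cplx U) (v : cplx V) : cplx W :=
  (op u.1 v.1 - op u.2 v.2, op u.1 v.2 + op u.2 v.1).

Definition cmul : cplx Cinfty -> cplx Cinfty -> cplx Cinfty :=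
  cbilin (fun f g => f * g).
Definition cscale : cplx Cinfty -> cplx sec -> cplx sec :=
  cbilin (fun f s => f *: s).
Definition cpairing : cplx sec -> cplx sec -> cplx Cinfty := cbilin pairing.
Definition ccourant : cplx sec -> cplx sec -> cplx sec := cbilin courant.
Definition anchor : cplx sec -> cplx vfield := clin (fun s : sec => s.1).

Definition alternating_bilinear (V : lmodType Cinfty)
    (w : V -> V -> Cinfty^o) : Prop :=
  [/\ forall v, linear (w v), forall v, linear (w^~ v) & forall v, w v v = 0].

Record two_form := MkTwoForm {
  tfun :> vfield -> vfield -> Cinfty^o; tfunP : alternating_bilinear tfun }.

Record bivector := MkBivector {
  bfun :> oform -> oform -> Cinfty^o; bfunP : alternating_bilinear bfun }.

Fact flat_subproof (theta : two_form) X : theta X \in oform_pred.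
Proof. by apply/asboolP; case: (tfunP theta). Qed.

Definition flat (theta : two_form) (X : vfield) : oform :=
  MkOform (flat_subproof theta X).

Fact transpose_subproof (phi : {linear vfield -> vfield}) (alpha : oform) :
  (fun X : vfield => alpha (phi X)) \in oform_pred.
Proof. by apply/asboolP => f X Y; rewrite linearP oformL. Qed.

Definition transpose (phi : {linear vfield -> vfield}) (alpha : oform) : oform :=
  MkOform (transpose_subproof phi alpha).

Definition is_sharp (pi : bivector) (pis : oform -> vfield) : Prop :=
  forall alpha beta : oform, beta (pis alpha) = pi alpha beta.

(* Phi is the block matrix ((phi, pi^sharp), (theta^flat, - phi^* )). *)
Definition has_components (Phi : sec -> sec) (pi : bivector) (theta : two_form)
    (phi : {linear vfield -> vfield}) : Prop :=
  exists2 pis, is_sharp pi pis & forall s,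
    Phi s = (phi s.1 + pis s.2, flat theta s.1 - transpose phi s.2).

Definition secV (X : vfield) : sec := (X, 0).
Definition secF (alpha : oform) : sec := (0, alpha).

Definition odot (F : vfield) (eta : oform) (s : sec) : sec :=
  ((eta s.1 : Cinfty) *: F, (s.2 F : Cinfty) *: eta).

(* A bundle endomorphism is a Cinfty-linear endomorphism of the module of
   sections. *)
Record generalized_almost_contact (Phi : {linear sec -> sec})
    (F : vfield) (eta : oform) : Prop := {
  gac_skew : forall s t, pairing (Phi s) t + pairing s (Phi t) = 0;
  gac_eta_F : eta F = 1;
  gac_Phi_F : Phi (secV F) = 0;
  gac_Phi_eta : Phi (secF eta) = 0;
  gac_square : forall s, Phi (Phi s) = - s + odot F eta s }.

Section subbundles.
Variables (Phi : sec -> sec) (F : vfield) (eta : oform).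

(* Below, bundles are represented by their sets of smooth sections. *)

(* sections of ker eta (+) ker F *)
Definition in_kers (e : sec) : Prop := eta e.1 = 0 /\ e.2 F = 0.

Definition line (s : sec) : set (cplx sec) :=
  [set cscale f (ofreal s) | f in [set: cplx Cinfty]].

Definition E10 : set (cplx sec) := [set ((e, - Phi e) : cplx sec) | e in in_kers].
Definition E01 : set (cplx sec) := [set ((e, Phi e) : cplx sec) | e in in_kers].

(* Sections of L = L_F (+) E^(1,0) and of L^* = L_eta (+) E^(0,1). *)
Definition bundleL : set (cplx sec) :=
  [set l + e | l in line (secV F) & e in E10].
Definition bundleLstar : set (cplx sec) :=
  [set l + e | l in line (secF eta) & e in E01].

Definition generalized_contact_closed : Prop :=
  forall s t, bundleL s -> bundleL t -> bundleL (ccourant s t).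

Definition nij (v0 v1 v2 : cplx sec) : cplx Cinfty :=
  (3^-1 : R) *: (cpairing (ccourant v0 v1) v2 + cpairing (ccourant v1 v2) v0
                 + cpairing (ccourant v2 v0) v1 : cplx Cinfty).

Definition evalF : cplx sec -> cplx Cinfty := clin (fun s : sec => s.2 F : Cinfty).

(* The projection of L^* onto E^(0,1) along L_eta. *)
Definition projE01 (v : cplx sec) : cplx sec :=
  v - cscale (evalF v) (ofreal (secF eta)).

Definition deta20 (v0 v1 : cplx sec) : cplx Cinfty :=
  cbilin (ext_d1 eta) (anchor (projE01 v0)) (anchor (projE01 v1)).

End subbundles.

Definition wedge12 (xi : cplx sec -> cplx Cinfty)
    (omega : cplx sec -> cplx sec -> cplx Cinfty) (v0 v1 v2 : cplx sec) :
    cplx Cinfty :=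
  cmul (xi v0) (omega v1 v2) + cmul (xi v1) (omega v2 v0)
  + cmul (xi v2) (omega v0 v1).

(* F is dual to eta on L^* = L_eta (+) E^(0,1), and [deta20] is the 2-form
   killed by eta that agrees with d eta on E^(0,1). *)

Lemma evalF_eta F (eta : oform) : eta F = 1 -> evalF F (ofreal (secF eta)) = (1, 0).
Proof. by move=> etaF; rewrite /evalF /clin /= etaF. Qed.

Lemma evalF_E01 (Phi : {linear sec -> sec}) F eta v :
  generalized_almost_contact Phi F eta -> E01 Phi F eta v -> evalF F v = 0.
Proof.
move=> [Phi_skew _ PhiF _ _] [e [_ eF]] <-; rewrite /evalF /clin /= eF.
congr (_, _); have := Phi_skew e (secV F); rewrite PhiF /pairing /=.
change (ofun 0 (Phi e).1 : Cinfty) with (0 : Cinfty).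
have oform0 (alpha : oform) : alpha 0 = 0.
  by have /= := oformL alpha (- 1) 0 0; rewrite scaler0 addr0 mulN1r addNr.
change (ofun 0 e.1 : Cinfty) with (0 : Cinfty).
rewrite oform0 !add0r scaler0 addr0 => /(congr1 (fun f => (2 : R) *: f)).
by rewrite scaler0 scalerA divff ?scale1r // pnatr_eq0.
Qed.

Lemma deta20_E01 (Phi : {linear sec -> sec}) F eta v0 v1 :
  generalized_almost_contact Phi F eta ->
  E01 Phi F eta v0 -> E01 Phi F eta v1 ->
  deta20 F eta v0 v1 = cbilin (ext_d1 eta) (anchor v0) (anchor v1).
Proof.
move=> J v0E v1E; rewrite /deta20 /projE01 !(evalF_E01 J) //.
have -> : cscale 0 (ofreal (secF eta)) = 0 :> cplx sec.
  by rewrite /cscale /cbilin /= !scale0r subrr addr0.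
by rewrite !subr0.
Qed.

Lemma deta20_eta F (eta : oform) v : eta F = 1 ->
  deta20 F eta (ofreal (secF eta)) v = 0.
Proof.
move=> etaF; rewrite /deta20 {1}/projE01 evalF_eta //.
have -> : cscale (1, 0) (ofreal (secF eta)) = ofreal (secF eta).
  rewrite /cscale /cbilin.
  change ((1 *: secF eta - 0 *: (0 : sec), 1 *: (0 : sec) + 0 *: secF eta) =
          ofreal (secF eta)).
  by rewrite !scale0r scaler0 scale1r subr0 addr0.
rewrite subrr; change (anchor 0) with ((0, 0) : cplx vfield).
have v0 (X : vfield) : X 0 = 0.
  by apply: (addrI (X 0)); rewrite -vfieldD !addr0.
have b0 (Y : vfield) : lie_bracket 0 Y = 0.
  apply: val_inj; apply/funext => f.
  by change (0 - Y (0 : Cinfty) = 0); rewrite v0 subr0.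
have e0 : eta 0 = 0.
  by have /= := oformL eta (- 1) 0 0; rewrite scaler0 addr0 mulN1r addNr.
have d0 (Y : vfield) : ext_d1 eta 0 Y = 0.
  rewrite /ext_d1 b0 e0 v0; change (0 - 0 - 0 = 0 :> Cinfty).
  by rewrite !subr0.
by rewrite /cbilin !d0 subr0 addr0.
Qed.

End smooth_functions.

(* Main.v *)
Require Import Defs.
From mathcomp Require Import all_boot all_order all_algebra.
From mathcomp Require Import all_classical all_reals.
Import GRing.Theory.
Local Open Scope ring_scope.
Set Implicit Arguments.
Unset Strict Implicit.

(** Write T(u, v, w) = <[[u, v]], w>.  Each of the three summands of Nij is
already equal to -1/2 F /\ (rho^* d eta)^(2,0) on L^*; averaging over the
cyclic permutations then changes nothing.

The value of T comes from splitting v_i = f_i eta + e_i with e_i in E^(0,1).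
All the anchors involved lie in ker eta.  If a is a 1-form killed by the
anchors X, Y of s, t, then [[a, s]] = - L_X a, so that
T(a, s, t) = 1/2 a([X, Y]), and the same value is found for T(t, a, s) and
T(s, t, a) ([pairing_courant_forml], [pairing_courant_formm],
[pairing_courant_formr]).  Since f eta has zero anchor and
d eta(X, Y) = - eta([X, Y]) on ker eta, the terms of T(v_0, v_1, v_2) that
involve some f_i eta add up to -1/2 times the wedge product
([courant3_line_sum],
[ext_d1_horizontal]).

What is left is T(e_0, e_1, e_2), and this is where integrability enters:
T commutes with complex conjugation, which exchanges E^(0,1) and E^(1,0), and
on E^(1,0) the bracket has values in L = L_F + E^(1,0), which is orthogonal to
E^(1,0) ([courant3_E01]).  The isotropy of E^(1,0) follows from Phi being
skew with Phi^2 = -1 on ker eta + ker F. *)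

(** * Complex-bilinear extensions and conjugation *)

Definition biadditive (U V W : zmodType) (op : U -> V -> W) : Prop :=
  (forall u u' v, op (u + u') v = op u v + op u' v) /\
  (forall u v v', op u (v + v') = op u v + op u v').

Section complexification.
Context (U V W : zmodType) (op : U -> V -> W).

(** Complex conjugation on a complexified module, u + i v being the pair (u, v). *)
Definition cconj (T : zmodType) (u : cplx T) : cplx T := (u.1, - u.2).

Lemma cconjK (T : zmodType) (u : cplx T) : cconj (cconj u) = u.
Proof. by case: u => a b; rewrite /cconj /= opprK. Qed.

Lemma biadditiveNl : biadditive op -> forall u v, op (- u) v = - op u v.
Proof.
move=> [Dl _] u v.
have op0 : op 0 v = 0 by apply: (addrI (op 0 v)); rewrite -Dl !addr0.
by apply: (addrI (op u v)); rewrite -Dl !subrr op0.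
Qed.

Lemma biadditiveNr : biadditive op -> forall u v, op u (- v) = - op u v.
Proof.
move=> [_ Dr] u v.
have op0 : op u 0 = 0 by apply: (addrI (op u 0)); rewrite -Dr !addr0.
by apply: (addrI (op u v)); rewrite -Dr !subrr op0.
Qed.

Lemma cbilin_conj : biadditive op -> forall u v,
  cbilin op (cconj u) (cconj v) = cconj (cbilin op u v).
Proof.
move=> opD u v; rewrite /cbilin /cconj /=.
by rewrite !biadditiveNl // !biadditiveNr // opprK opprD.
Qed.

Lemma cbilinDl : biadditive op -> forall u u' v,
  cbilin op (u + u') v = cbilin op u v + cbilin op u' v.
Proof.
move=> [Dl _] u u' v; rewrite /cbilin.
change ((op (u.1 + u'.1) v.1 - op (u.2 + u'.2) v.2,
         op (u.1 + u'.1) v.2 + op (u.2 + u'.2) v.1) =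
  ((op u.1 v.1 - op u.2 v.2) + (op u'.1 v.1 - op u'.2 v.2),
   (op u.1 v.2 + op u.2 v.1) + (op u'.1 v.2 + op u'.2 v.1))).
by rewrite !Dl opprD addrACA (addrACA (op u.1 _) _ (op u.2 _)).
Qed.

Lemma cbilinDr : biadditive op -> forall u v v',
  cbilin op u (v + v') = cbilin op u v + cbilin op u v'.
Proof.
move=> [_ Dr] u v v'; rewrite /cbilin.
change ((op u.1 (v.1 + v'.1) - op u.2 (v.2 + v'.2),
         op u.1 (v.2 + v'.2) + op u.2 (v.1 + v'.1)) =
  ((op u.1 v.1 - op u.2 v.2) + (op u.1 v'.1 - op u.2 v'.2),
   (op u.1 v.2 + op u.2 v.1) + (op u.1 v'.2 + op u.2 v'.1))).
by rewrite !Dr opprD addrACA (addrACA (op u.1 _) _ (op u.2 _)).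
Qed.

End complexification.

(** * Real identities for the bracket and the pairing *)

Section real_courant.
Context {R : realType} {n : nat} {M : manifold R n}.
Implicit Types (X Y : vfield M) (a b : oform M) (s t u : sec M).
Local Notation C := (Cinfty M).

Lemma oformD a X Y : a (X + Y) = a X + a Y :> C.
Proof. by have := oformL a 1 X Y; rewrite scale1r mul1r. Qed.

Lemma oform0 a : a 0 = 0 :> C.
Proof. by apply: (addrI (a 0 : C)); rewrite -oformD !addr0. Qed.

Lemma oformN a X : a (- X) = - a X :> C.
Proof. by apply: (addrI (a X : C)); rewrite -oformD !subrr oform0. Qed.

Lemma oformZ a (f : C) X : a (f *: X) = f * a X :> C.
Proof. by have := oformL a f X 0; rewrite oform0 !addr0. Qed.

Lemma vfield0 X : X 0 = 0.
Proof. by have := vfieldB X 0 0; rewrite !subrr. Qed.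

Lemma vfieldN X (f : C) : X (- f) = - X f.
Proof. by rewrite -(sub0r f) vfieldB vfield0 sub0r. Qed.

Lemma oform_scaleE (f : C) a X : (f *: a) X = f * a X :> C. Proof. by []. Qed.

Lemma lie_bracketDl X X' Y :
  lie_bracket (X + X') Y = lie_bracket X Y + lie_bracket X' Y.
Proof.
apply: val_inj; apply/funext => g.
change (X (Y g) + X' (Y g) - Y (X g + X' g : C) =
  (X (Y g) - Y (X g)) + (X' (Y g) - Y (X' g)) :> C).
by rewrite vfieldD opprD addrACA.
Qed.

Lemma lie_bracketC X Y : lie_bracket X Y = - lie_bracket Y X.
Proof.
apply: val_inj; apply/funext => g.
change (X (Y g) - Y (X g) = - (Y (X g) - X (Y g)) :> C).
by rewrite opprB.
Qed.

Lemma lie_formDl X X' b : lie_form (X + X') b = lie_form X b + lie_form X' b.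
Proof.
apply: val_inj; apply/funext => Z.
change ((X (b Z) + X' (b Z)) - b (lie_bracket (X + X') Z) =
  (X (b Z) - b (lie_bracket X Z)) + (X' (b Z) - b (lie_bracket X' Z)) :> C).
by rewrite lie_bracketDl oformD opprD addrACA.
Qed.

Lemma lie_formDr X b b' : lie_form X (b + b') = lie_form X b + lie_form X b'.
Proof.
apply: val_inj; apply/funext => Z.
change (X (b Z + b' Z : C) - (b (lie_bracket X Z) + b' (lie_bracket X Z)) =
  (X (b Z) - b (lie_bracket X Z)) + (X (b' Z) - b' (lie_bracket X Z)) :> C).
by rewrite vfieldD opprD addrACA.
Qed.

Lemma ext_d0D (f g : C) : ext_d0 (f + g) = ext_d0 f + ext_d0 g.
Proof. by apply: val_inj; apply/funext => Z; exact: vfieldD. Qed.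

Lemma ext_d0N (f : C) : ext_d0 (- f) = - ext_d0 f.
Proof. by apply: val_inj; apply/funext => Z; exact: vfieldN. Qed.

Lemma courantC s t : courant s t = - courant t s.
Proof.
rewrite /courant.
change ((lie_bracket s.1 t.1, lie_form s.1 t.2 - lie_form t.1 s.2 -
    ext_d0 ((2^-1 : R) *: (t.2 s.1 - s.2 t.1 : C))) =
  (- lie_bracket t.1 s.1, - (lie_form t.1 s.2 - lie_form s.1 t.2 -
    ext_d0 ((2^-1 : R) *: (s.2 t.1 - t.2 s.1 : C))))).
rewrite -lie_bracketC -(opprB (s.2 t.1 : C)) scalerN ext_d0N opprK !opprB.
by rewrite addrC.
Qed.

Lemma courantDl s s' t : courant (s + s') t = courant s t + courant s' t.
Proof.
congr (_, _); first exact: lie_bracketDl.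
rewrite lie_formDl lie_formDr.
have -> : (2^-1 : R) *: (t.2 (s + s').1 - (s + s').2 t.1 : C) =
  (2^-1 : R) *: (t.2 s.1 - s.2 t.1 : C) +
  (2^-1 : R) *: (t.2 s'.1 - s'.2 t.1 : C).
  rewrite -scalerDr; congr (_ *: _).
  change (t.2 (s.1 + s'.1) - (s.2 t.1 + s'.2 t.1) =
    (t.2 s.1 - s.2 t.1) + (t.2 s'.1 - s'.2 t.1) :> C).
  by rewrite oformD opprD addrACA.
rewrite ext_d0D !opprD (addrACA (lie_form s.1 _)).
by rewrite (addrACA (lie_form s.1 _ - _)).
Qed.

Lemma courantDr s t t' : courant s (t + t') = courant s t + courant s t'.
Proof. by rewrite courantC courantDl opprD -!courantC. Qed.

Lemma pairingDl s s' t : pairing (s + s') t = pairing s t + pairing s' t.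
Proof.
rewrite /pairing -scalerDr; congr (_ *: _).
change (t.2 (s.1 + s'.1) + (s.2 t.1 + s'.2 t.1) =
  (t.2 s.1 + s.2 t.1) + (t.2 s'.1 + s'.2 t.1) :> C).
by rewrite oformD addrACA.
Qed.

Lemma pairingC s t : pairing s t = pairing t s.
Proof. by rewrite /pairing addrC. Qed.

Lemma pairingDr s t t' : pairing s (t + t') = pairing s t + pairing s t'.
Proof. by rewrite pairingC pairingDl !(pairingC s). Qed.

Lemma pairing0l t : pairing 0 t = 0.
Proof. by apply: (addrI (pairing 0 t)); rewrite -pairingDl !addr0. Qed.

Lemma pairing_formE a t : pairing (secF a) t = (2^-1 : R) *: (a t.1 : C).
Proof.
congr (_ *: _); change (t.2 0 + a t.1 = a t.1 :> C).
by rewrite oform0 add0r.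
Qed.

Lemma pairing_vectorE s X : pairing s (secV X) = (2^-1 : R) *: (s.2 X : C).
Proof. by congr (_ *: _); exact: add0r. Qed.

Lemma half_eq0 (f : C) : (2^-1 : R) *: f = 0 -> f = 0.
Proof.
move=> /(congr1 (fun g => (2 : R) *: g)).
by rewrite scaler0 scalerA divff ?scale1r // Num.Theory.pnatr_eq0.
Qed.

Lemma lie_bracket0l Y : lie_bracket 0 Y = 0.
Proof. by apply: (addrI (lie_bracket 0 Y)); rewrite -lie_bracketDl !addr0. Qed.

(** The general formula is [[a, s]] = - L_X a + 1/2 d(a(X)), where X is the
anchor of s. *)
Lemma courant_form a s : a s.1 = 0 :> C ->
  courant (secF a) s = secF (- lie_form s.1 a).
Proof.
move=> as0; congr (_, _); first exact: lie_bracket0l.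
change (lie_form 0 s.2 - lie_form s.1 a -
  ext_d0 ((2^-1 : R) *: (s.2 0 - a s.1 : C)) = - lie_form s.1 a).
have -> : lie_form 0 s.2 = 0.
  apply: val_inj; apply/funext => Z.
  change (0 - s.2 (lie_bracket 0 Z) = 0 :> C).
  by rewrite lie_bracket0l oform0 subr0.
have ext0 : ext_d0 (0 : C) = 0.
  by apply: (addrI (ext_d0 (0 : C))); rewrite -ext_d0D !addr0.
by rewrite oform0 as0 subrr scaler0 ext0 subr0 sub0r.
Qed.

(** This lemma and its variants [pairing_courant_formm] and
[pairing_courant_formr] place a 1-form in each of the three slots of
<[[., .]], .>, with the other two arguments in the same cyclic order: the
value does not change. *)
Lemma pairing_courant_forml a s t : a s.1 = 0 :> C -> a t.1 = 0 :> C ->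
  pairing (courant (secF a) s) t = (2^-1 : R) *: (a (lie_bracket s.1 t.1) : C).
Proof.
move=> as0 at0; rewrite courant_form // pairing_formE; congr (_ *: _).
change (- (s.1 (a t.1) - a (lie_bracket s.1 t.1)) = a (lie_bracket s.1 t.1) :> C).
by rewrite at0 vfield0 sub0r opprK.
Qed.

Lemma pairingNl s t : pairing (- s) t = - pairing s t.
Proof. by apply: (addrI (pairing s t)); rewrite -pairingDl !subrr pairing0l. Qed.

Lemma pairingNr s t : pairing s (- t) = - pairing s t.
Proof. by rewrite pairingC pairingNl pairingC. Qed.

Lemma pairing_courant_formm a s t : a s.1 = 0 :> C -> a t.1 = 0 :> C ->
  pairing (courant t (secF a)) s = (2^-1 : R) *: (a (lie_bracket s.1 t.1) : C).
Proof.
move=> as0 at0; rewrite courantC pairingNl pairing_courant_forml //.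
by rewrite -scalerN lie_bracketC oformN opprK.
Qed.

Lemma pairing_courant_formr a s t :
  pairing (courant s t) (secF a) = (2^-1 : R) *: (a (lie_bracket s.1 t.1) : C).
Proof. by rewrite pairingC pairing_formE. Qed.

Lemma biadditive_pairing : biadditive (@pairing _ _ M).
Proof. split=> *; [exact: pairingDl|exact: pairingDr]. Qed.

Lemma biadditive_courant : biadditive (@courant _ _ M).
Proof. split=> *; [exact: courantDl|exact: courantDr]. Qed.

End real_courant.

(** * The complex trilinear function <[[u, v]], w> *)

Section complex_courant.
Context {R : realType} {n : nat} {M : manifold R n}.
Implicit Types (eta : oform M) (f : cplx (Cinfty M)) (e u v w : cplx (sec M)).
Local Notation C := (Cinfty M).

(** The anchor of e lies in the complexification of ker eta. *)
Definition horizontal eta e : Prop := eta e.1.1 = 0 :> C /\ eta e.2.1 = 0 :> C.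

(** The complex-linear extension of eta to complex vector fields. *)
Definition ccontract eta (X : cplx (vfield M)) : cplx C :=
  (eta X.1 : C, eta X.2 : C).

(** The section f eta of L_eta, for a complex-valued function f. *)
Definition form_multiple f eta : cplx (sec M) := cscale f (ofreal (secF eta)).

Lemma form_multipleE f eta :
  form_multiple f eta = (secF ((f.1 : C) *: eta), secF ((f.2 : C) *: eta)).
Proof.
rewrite /form_multiple /cscale /cbilin.
change (((f.1 : C) *: secF eta - (f.2 : C) *: (0 : sec M),
         (f.1 : C) *: (0 : sec M) + (f.2 : C) *: secF eta) =
        (secF ((f.1 : C) *: eta), secF ((f.2 : C) *: eta))).
rewrite !scaler0 subr0 add0r.
have secFZ (g : C) : g *: secF eta = secF (g *: eta).
  by congr (_, _); exact: scaler0.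
by rewrite !secFZ.
Qed.

(** <[[u, v]], w>, whose cyclic sum is three times the Nijenhuis operator. *)
Definition courant3 u v w : cplx C := cpairing (ccourant u v) w.

Lemma courant3Dl u u' v w :
  courant3 (u + u') v w = courant3 u v w + courant3 u' v w.
Proof.
rewrite /courant3 /ccourant /cpairing.
by rewrite cbilinDl ?cbilinDl //;
  [exact: biadditive_pairing|exact: biadditive_courant].
Qed.

Lemma courant3Dm u v v' w :
  courant3 u (v + v') w = courant3 u v w + courant3 u v' w.
Proof.
rewrite /courant3 /ccourant /cpairing.
by rewrite cbilinDr ?cbilinDl //;
  [exact: biadditive_pairing|exact: biadditive_courant].
Qed.

Lemma courant3Dr u v w w' :
  courant3 u v (w + w') = courant3 u v w + courant3 u v w'.
Proof. by rewrite /courant3 /cpairing cbilinDr //; exact: biadditive_pairing. Qed.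

Lemma courant3_conj u v w :
  courant3 (cconj u) (cconj v) (cconj w) = cconj (courant3 u v w).
Proof.
rewrite /courant3 /ccourant /cpairing !cbilin_conj //.
- exact: biadditive_pairing.
- exact: biadditive_courant.
Qed.

(** eta([rho u, rho v]). *)
Definition eta_bracket eta u v : cplx C :=
  ccontract eta (cbilin (@lie_bracket _ _ M) (anchor u) (anchor v)).

Lemma courant3E u v w : courant3 u v w =
  (pairing (courant u.1 v.1) w.1 - pairing (courant u.2 v.2) w.1
   - (pairing (courant u.1 v.2) w.2 + pairing (courant u.2 v.1) w.2),
   pairing (courant u.1 v.1) w.2 - pairing (courant u.2 v.2) w.2
   + (pairing (courant u.1 v.2) w.1 + pairing (courant u.2 v.1) w.1)).
Proof.
rewrite /courant3 /cpairing /ccourant /cbilin.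
cbn [fst snd].
by rewrite !pairingDl !pairingNl.
Qed.

(** Expansion into real components, in the shape produced by [courant3E]. *)
Lemma cmul_eta_bracket f eta u v : (2^-1 : R) *: cmul f (eta_bracket eta u v) =
  let k (X Y : vfield M) (g : C) := (2^-1 : R) *: (g * eta (lie_bracket X Y)) in
  (k u.1.1 v.1.1 f.1 - k u.2.1 v.2.1 f.1 - (k u.1.1 v.2.1 f.2 + k u.2.1 v.1.1 f.2),
   k u.1.1 v.2.1 f.1 + k u.2.1 v.1.1 f.1 + (k u.1.1 v.1.1 f.2 - k u.2.1 v.2.1 f.2)).
Proof.
cbv zeta; rewrite /eta_bracket /ccontract /cbilin /anchor /clin.
cbn [fst snd].
rewrite !oformD !oformN.
rewrite -!scalerN -!scalerDr -!mulrN -!mulrDr -scalerBr.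
reflexivity.
Qed.

Lemma courant3_forml f eta e e' : horizontal eta e -> horizontal eta e' ->
  courant3 (form_multiple f eta) e e' =
    (2^-1 : R) *: cmul f (eta_bracket eta e e').
Proof.
move=> [h1 h2] [h1' h2'].
have Z0 (g : C) X : eta X = 0 :> C -> (g *: eta) X = 0 :> C.
  by move=> eX; rewrite oform_scaleE eX mulr0.
rewrite cmul_eta_bracket courant3E form_multipleE; cbn [fst snd].
(* Only K is needed about the pairing and the bracket; abstracting them keeps
   the rewriting from unfolding their definitions. *)
have K := @pairing_courant_forml R n M.
move: (@pairing R n M) (@courant R n M) K => p c K.
rewrite !(K _ _ _ (Z0 _ _ h1) (Z0 _ _ h1')).
rewrite !(K _ _ _ (Z0 _ _ h1) (Z0 _ _ h2')).
rewrite !(K _ _ _ (Z0 _ _ h2) (Z0 _ _ h1')).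
rewrite !(K _ _ _ (Z0 _ _ h2) (Z0 _ _ h2')).
rewrite !oform_scaleE; cbv zeta.
congr (_, _).
  by rewrite -!addrA -!opprD; congr (_ - _); rewrite addrC addrA.
by rewrite addrACA; congr (_ + _); exact: addrC.
Qed.

Lemma courant3_formr f eta e e' :
  courant3 e e' (form_multiple f eta) =
    (2^-1 : R) *: cmul f (eta_bracket eta e e').
Proof.
rewrite cmul_eta_bracket courant3E form_multipleE; cbn [fst snd].
have K := @pairing_courant_formr R n M.
move: (@pairing R n M) (@courant R n M) K => p c K.
rewrite !K.
rewrite !oform_scaleE; cbv zeta.
by congr (_, _); exact: addrC.
Qed.

Lemma courant3_formm f eta e e' : horizontal eta e -> horizontal eta e' ->
  courant3 e' (form_multiple f eta) e =
    (2^-1 : R) *: cmul f (eta_bracket eta e e').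
Proof.
move=> [h1 h2] [h1' h2'].
have Z0 (g : C) X : eta X = 0 :> C -> (g *: eta) X = 0 :> C.
  by move=> eX; rewrite oform_scaleE eX mulr0.
rewrite cmul_eta_bracket courant3E form_multipleE; cbn [fst snd].
have K := @pairing_courant_formm R n M.
move: (@pairing R n M) (@courant R n M) K => p c K.
rewrite !(K _ _ _ (Z0 _ _ h1) (Z0 _ _ h1')).
rewrite !(K _ _ _ (Z0 _ _ h1) (Z0 _ _ h2')).
rewrite !(K _ _ _ (Z0 _ _ h2) (Z0 _ _ h1')).
rewrite !(K _ _ _ (Z0 _ _ h2) (Z0 _ _ h2')).
rewrite !oform_scaleE; cbv zeta; congr (_, _).
  by rewrite -!addrA -!opprD; congr (_ - _); rewrite addrA addrC.
set q := (2^-1 *: (f.2 * eta (lie_bracket e.2.1 e'.2.1)) : C).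
set s := (2^-1 *: (f.1 * eta (lie_bracket e.1.1 e'.2.1)) : C).
by rewrite addrC (addrC _ s) addrACA.
Qed.

Lemma anchor_form_multiple f eta v : anchor (form_multiple f eta + v) = anchor v.
Proof.
rewrite form_multipleE.
change ((0 + v.1.1, 0 + v.2.1) = (v.1.1, v.2.1)).
by rewrite !add0r.
Qed.

Lemma horizontal_form_multipleD f eta v :
  horizontal eta v -> horizontal eta (form_multiple f eta + v).
Proof.
move=> [v1 v2]; have /pair_equal_spec[E1 E2] := anchor_form_multiple f eta v.
by split; [rewrite E1|rewrite E2].
Qed.

Lemma anchor_projE01 F eta v : anchor (projE01 F eta v) = anchor v.
Proof.
rewrite -[in RHS](subrK (form_multiple (evalF F v) eta) v) addrC.
by rewrite anchor_form_multiple.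
Qed.

Lemma ext_d1_horizontal eta u v : horizontal eta u -> horizontal eta v ->
  cbilin (ext_d1 eta) (anchor u) (anchor v) = - eta_bracket eta u v.
Proof.
move=> [u1 u2] [v1 v2].
have dE X Y : eta X = 0 :> C -> eta Y = 0 :> C ->
    ext_d1 eta X Y = - eta (lie_bracket X Y) :> C.
  by move=> eX eY; rewrite /ext_d1 eX eY !vfield0 subr0 sub0r.
rewrite /eta_bracket /ccontract /cbilin /anchor /clin; cbn [fst snd].
rewrite !dE // !oformD oformN.
set a := eta _; set b := eta _; set c := eta _; set d := eta _.
change ((- (a : C) - - (b : C), - (c : C) - (d : C)) =
        (- ((a : C) - (b : C)), - ((c : C) + (d : C)))).
by rewrite !opprD.
Qed.

(** A section f eta + e is horizontal with the same anchor as e, so the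
summands f_i eta can be removed one slot at a time, without expanding the
product into eight terms. *)
Lemma courant3_line_sum eta (f0 f1 f2 : cplx C) e0 e1 e2 :
  horizontal eta e0 -> horizontal eta e1 -> horizontal eta e2 ->
  courant3 (form_multiple f0 eta + e0) (form_multiple f1 eta + e1)
           (form_multiple f2 eta + e2) =
  (2^-1 : R) *: (cmul f0 (eta_bracket eta e1 e2) + cmul f1 (eta_bracket eta e2 e0)
                 + cmul f2 (eta_bracket eta e0 e1)) + courant3 e0 e1 e2.
Proof.
move=> h0 h1 h2.
have H1 := horizontal_form_multipleD f1 h1.
have H2 := horizontal_form_multipleD f2 h2.
rewrite courant3Dl courant3_forml // courant3Dm courant3_formm //.
rewrite courant3Dr courant3_formr !scalerDr !addrA.
by rewrite /eta_bracket !anchor_form_multiple.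
Qed.

End complex_courant.

(** * The bundles E^(1,0) and E^(0,1) of a generalized almost contact pair *)

Section almost_contact.
Context {R : realType} {n : nat} {M : manifold R n}.
Context (Phi : {linear sec M -> sec M}) (F : vfield M) (eta : oform M).
Context (J : generalized_almost_contact Phi F eta).
Local Notation C := (Cinfty M).

(** ker eta + ker F is the orthogonal complement of F and eta; this makes it
stable under the skew operator Phi, which kills both. *)
Lemma in_kers_pairing (s : sec M) :
  in_kers F eta s <-> pairing s (secV F) = 0 /\ pairing s (secF eta) = 0.
Proof.
rewrite pairing_vectorE pairingC pairing_formE; split.
  by case=> -> ->; rewrite !scaler0.
by case=> /half_eq0 sF /half_eq0 es.
Qed.

Lemma in_kers_Phi (s : sec M) : in_kers F eta s -> in_kers F eta (Phi s).
Proof.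
move=> /in_kers_pairing[sF se]; apply/in_kers_pairing; split.
  have := gac_skew J s (secV F).
  by rewrite (gac_Phi_F J) (pairingC s) pairing0l addr0.
have := gac_skew J s (secF eta).
by rewrite (gac_Phi_eta J) (pairingC s) pairing0l addr0.
Qed.

Lemma horizontal_E01 v : E01 Phi F eta v -> horizontal eta v.
Proof. by move=> [e ke <-]; split; [case: ke | case: (in_kers_Phi ke)]. Qed.

Lemma cconj_E01 v : E01 Phi F eta v -> E10 Phi F eta (cconj v).
Proof. by move=> [e ke <-]; exists e. Qed.

(** Phi is orthogonal on ker eta + ker F, being skew with Phi^2 = -1 there. *)
Lemma pairing_PhiPhi s t : in_kers F eta t ->
  pairing (Phi s) (Phi t) = pairing s t.
Proof.
move=> [et tF].
have := gac_skew J s (Phi t); rewrite (gac_square J) /odot et tF !scale0r addr0.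
rewrite pairingNr => /eqP.
by rewrite subr_eq0 => /eqP.
Qed.

Lemma cpairing_E10 u v : E10 Phi F eta u -> E10 Phi F eta v -> cpairing u v = 0.
Proof.
move=> [e ke <-] [e' ke' <-]; rewrite /cpairing /cbilin /=.
rewrite !pairingNl !pairingNr opprK pairing_PhiPhi // subrr.
by rewrite -opprD addrC (gac_skew J) oppr0.
Qed.

Lemma cpairing_line_F u v : line (secV F) u -> E10 Phi F eta v -> cpairing u v = 0.
Proof.
move=> [f _ <-] [e ke <-].
have pair0 (g : C) (s : sec M) : in_kers F eta s -> pairing (g *: secV F) s = 0.
  move=> [_ sF]; rewrite pairingC /pairing.
  change ((2^-1 : R) *: ((g * 0 : C) + s.2 (g *: F) : C) = 0).
  by rewrite oformZ sF !mulr0 addr0 scaler0.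
have kPe := in_kers_Phi ke.
rewrite /cscale /cpairing /cbilin /ofreal; cbn [fst snd].
rewrite !scaler0 subr0 add0r !pairingNr !pair0 //.
by rewrite oppr0 subr0 addr0.
Qed.

Lemma E10_bundleL v : E10 Phi F eta v -> bundleL Phi F eta v.
Proof.
move=> vE; exists 0; last by exists v => //; rewrite add0r.
exists 0 => //; rewrite /cscale /cbilin.
by rewrite !scale0r subr0 addr0.
Qed.

Lemma courant3_E01 : generalized_contact_closed Phi F eta ->
  forall v0 v1 v2, E01 Phi F eta v0 -> E01 Phi F eta v1 -> E01 Phi F eta v2 ->
  courant3 v0 v1 v2 = 0.
Proof.
move=> closedL v0 v1 v2 /cconj_E01 E0 /cconj_E01 E1 /cconj_E01 E2.
rewrite -[LHS]cconjK -courant3_conj /courant3.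
have [l lF [e eE <-]] := closedL _ _ (E10_bundleL E0) (E10_bundleL E1).
have -> : cpairing (l + e) (cconj v2) =
    cpairing l (cconj v2) + cpairing e (cconj v2).
  exact: cbilinDl biadditive_pairing _ _ _.
rewrite (cpairing_line_F lF E2) (cpairing_E10 eE E2) addr0.
by congr (_, _); exact: oppr0.
Qed.

Lemma evalF_line_sum f v :
  E01 Phi F eta v -> evalF F (form_multiple f eta + v) = f.
Proof.
move=> vE; have := evalF_E01 J vE; rewrite form_multipleE /evalF /clin => -[v1 v2].
change ((f.1 * eta F + v.1.2 F : C, f.2 * eta F + v.2.2 F : C) = f).
by rewrite (gac_eta_F J) v1 v2 !mulr1 !addr0; case: f.
Qed.

(** A single summand of the cyclic sum already has the claimed value. *)
Lemma courant3_Lstar : generalized_contact_closed Phi F eta ->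
  forall v0 v1 v2, bundleLstar Phi F eta v0 -> bundleLstar Phi F eta v1 ->
  bundleLstar Phi F eta v2 ->
  courant3 v0 v1 v2 = - (2^-1 : R) *: wedge12 (evalF F) (deta20 F eta) v0 v1 v2.
Proof.
move=> closedL v0 v1 v2 [_ [f0 _ <-] [e0 E0 <-]] [_ [f1 _ <-] [e1 E1 <-]]
  [_ [f2 _ <-] [e2 E2 <-]].
rewrite -!/(form_multiple _ eta).
have [[h0 h1] h2] := (horizontal_E01 E0, horizontal_E01 E1, horizontal_E01 E2).
rewrite courant3_line_sum // courant3_E01 // addr0.
rewrite /wedge12 !evalF_line_sum // /deta20 !anchor_projE01 !anchor_form_multiple.
rewrite !ext_d1_horizontal // scaleNr -scalerN !opprD.
have cmulN (f g : cplx C) : cmul f (- g) = - cmul f g.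
  by apply: biadditiveNr; split=> *; rewrite /cmul ?cbilinDl ?cbilinDr //;
    split=> *; rewrite ?mulrDl ?mulrDr.
by rewrite !cmulN !opprK.
Qed.

End almost_contact.

Theorem proposition2p6 (R : realType) (n : nat) (n_odd : odd n)
    (M : manifold R n)
    (F : vfield M) (eta : oform M) (pi : bivector M) (theta : two_form M)
    (phi : {linear vfield M -> vfield M}) (Phi : {linear sec M -> sec M})
    (Phi_components : has_components Phi pi theta phi)
    (almost_contact : generalized_almost_contact Phi F eta)
    (integrable : generalized_contact_closed Phi F eta) :
  forall v0 v1 v2 : cplx (sec M),
    bundleLstar Phi F eta v0 -> bundleLstar Phi F eta v1 ->
    bundleLstar Phi F eta v2 ->
    nij v0 v1 v2 = - (2^-1 : R) *: wedge12 (evalF F) (deta20 F eta) v0 v1 v2.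
Proof.
move=> v0 v1 v2 L0 L1 L2; rewrite /nij -!/(courant3 _ _ _).
have T := courant3_Lstar almost_contact integrable.
have wedgeC u v w : wedge12 (evalF F) (deta20 F eta) v w u =
    wedge12 (evalF F) (deta20 F eta) u v w.
  by rewrite /wedge12 addrC addrA.
rewrite (T _ _ _ L0 L1 L2) (T _ _ _ L1 L2 L0) (T _ _ _ L2 L0 L1).
rewrite (wedgeC v0) -(wedgeC v2).
set w := _ *: wedge12 _ _ _ _ _.
have -> : w + w + w = (3 : R) *: w.
  by rewrite scaler_nat !mulrS mulr0n addr0 addrA.
by rewrite scalerA mulVf ?scale1r // Num.Theory.pnatr_eq0.
Qed.
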